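(* The relation $\ll$ on $\mathcal W$ satisfies the following properties: (a) for every $\omega\in\mathcal W$ there exists $\omega'\in\mathcal W$ such that $\omega\ll\omega'$; (b) for every $\omega\in\mathcal W$ there exists $\omega_1\in\mathcal W$ such that $\omega_1\ll\omega$; (c) for all $\omega_1,\omega_2\in\mathcal W$ such that $\omega_1\ll\omega_2$ there exists $\omega_3\in\mathcal W$ such that $\omega_1\ll\omega_3\ll\omega_2$; (d) for all $\omega_1,\omega_2\in\mathcal W$ there exists $\omega_3\in\mathcal W$ such that $\omega_1\ll\omega_3$ and $\omega_2\ll\omega_3$.
   Context: $\mathbb R^+=[0,\infty)$. $\mathcal W$ is the set of all nondecreasing continuous functions $\omega:\mathbb R^+\to\mathbb R^+$ such that $\omega(0)=0$; $\omega(x+y)\le\omega(x)+\omega(y)$ for all $x,y\ge 0$; $\int_1^\infty \frac{\omega(t)}{t^2}\,dt<\infty$; and $\lim_{t\to\infty}\frac{\omega(t)}{\log(1+t)}=\infty$. For $\omega_1,\omega_2\in\mathcal W$, $\omega_1\ll\omega_2$ means $\omega_1(t)=o(\omega_2(t))$ as $t\to\infty$. *)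

(* Defs.v *)
From HB Require Import structures.
From mathcomp Require Import all_boot all_order all_algebra.
From mathcomp Require Import all_classical all_reals all_analysis.
Import Order.TTheory GRing.Theory Num.Theory.
Import numFieldNormedType.Exports.

Set Implicit Arguments.
Unset Strict Implicit.
Unset Printing Implicit Defensive.

Local Open Scope classical_set_scope.
Local Open Scope ring_scope.

(* A function [0, oo) -> [0, oo) is represented by a
   function R -> R, all conditions on which only concern arguments >= 0; the
   values at negative arguments are irrelevant. *)
Record weight (R : realType) (w : R -> R) : Prop := Weight {
  weight_ge0 : forall x, 0 <= x -> 0 <= w x ;
  weight_nondecreasing : forall x y, 0 <= x -> x <= y -> w x <= w y ;
  weight_continuous : {within `[0, +oo[, continuous w} ;
  weight0 : w 0 = 0 ;
  weight_subadditive :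
    forall x y, 0 <= x -> 0 <= y -> w (x + y) <= w x + w y ;
  weight_integral :
    (\int[@lebesgue_measure R]_(t in `[1%R, +oo[) (w t / t ^+ 2)%:E < +oo)%E ;
  weight_ln : w t / ln (1 + t) @[t --> +oo] --> +oo
}.

(* Needed to state =o_ at +oo: the library does not register pinfty_nbhs as a
   canonical filter_on.  See llP for the unfolded meaning. *)
Canonical pinfty_filter_on (R : realType) : filter_on R :=
  FilterType (pinfty_nbhs R) _.

Definition ll (R : realType) (w1 w2 : R -> R) : Prop :=
  w1 =o_ (pinfty_nbhs R) w2.

Lemma llP (R : realType) (w1 w2 : R -> R) :
  ll w1 w2 <->
  forall e, 0 < e -> \forall t \near +oo, `|w1 t| <= e * `|w2 t|.
Proof. exact: eqoP. Qed.

Notation "w1 ≪ w2" := (ll w1 w2) (at level 70, no associativity).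

(* Main.v *)
Require Import Defs.
From mathcomp Require Import all_boot all_order all_algebra.
From mathcomp Require Import all_classical all_reals all_analysis.
From mathcomp Require Import measurable_realfun ring lra.
Import Order.TTheory GRing.Theory Num.Theory.
Import numFieldNormedType.Exports.
Set Implicit Arguments.
Unset Strict Implicit.
Unset Printing Implicit Defensive.

(** A weight may be modified freely as long as three features survive:
    subadditivity, convergence of its integral, and growth beyond the
    logarithm.  Subadditivity is the delicate one, since it is lost under
    truncations and minima.  Two operations preserve it: sums, and the Lipschitz
    envelope
      f_e(x) = inf_(0 <= s <= x) (f(s) + e (x - s)),
    the infimal convolution of f with the linear function e x.  The envelope is
    dominated by both f(x) and e x.  If moreover f(t) = o(t), then
    f - C_e <= f_e for some constant C_e, because
    f(x) <= f(s) + f(x - s) <= f(s) + C_e + e (x - s).  Thus f_e is a copy of f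
    whose onset is delayed: it is as small as desired on a prescribed bounded
    interval, yet differs from f by a bounded amount.

    Every part follows from F = sum_k f_(e_k) with 0 < e_k <= 2^-(k+1).  This
    sum converges because it is at most x; it is subadditive, hence 1-Lipschitz;
    and since N f - C <= F for every N while f tends to infinity, f is o(F)
    ([ll_lip_env_sum]).  It remains to choose the slopes e_k small enough.

    - To go above a weight, or above the sum of two ([weight_above]): by
      dominated convergence the integral of f_e(t)/t^2 tends to 0 with e, so
      the e_k can be taken with integrals summing to at most 1.

    - To squeeze F between f and a weight w with f = o(w) ([modulus_between]):
      choosing e_k <= 2^-(k+1)/T, where f <= 2^-(k+1) w past T, gives
      f_(e_k) <= 2^-(k+1) (1 + w), whence F <= N f + 2^-N (1 + w) for all N, so
      F = o(w).  Finding a weight below w is the case f(t) = log(1 + t), which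
      makes F exceed the logarithm.

    That a weight is o(t) comes from the convergence of its integral: the
    integral over [n, 2n] tends to 0 and is at least w(n)/(4n)
    ([sublinear_of_nqa]). *)

Local Open Scope classical_set_scope.
Local Open Scope ring_scope.

(** * Moduli: subadditive nondecreasing functions *)

(** Weights and t |-> log(1 + t) are treated on the same footing: this record
    keeps the conditions they share. *)
Record modulus (R : realType) (f : R -> R) : Prop := Modulus {
  modulus_ge0 : forall x, 0 <= x -> 0 <= f x ;
  modulus_nondecreasing : forall x y, 0 <= x -> x <= y -> f x <= f y ;
  modulus0 : f 0 = 0 ;
  modulus_subadditive :
    forall x y, 0 <= x -> 0 <= y -> f (x + y) <= f x + f y
}.

(** The relation f(t) = o(t) at infinity, in the additive form consumed by
    subadditivity. *)
Definition sublinear (R : realType) (f : R -> R) : Prop :=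
  forall e, 0 < e -> exists2 C, 0 <= C & forall t, 0 <= t -> f t <= C + e * t.

(** The infimal convolution of f with the linear function of slope e, on the
    half-line. *)
Definition lip_env (R : realType) (f : R -> R) (e x : R) : R :=
  inf [set f s + e * (x - s) | s in `[0, x]].

(** The sum of the series of u, as a supremum of partial sums: as the terms are
    nonnegative, upper bounds on all partial sums pass to it at once. *)
Definition sup_sum (R : realType) (u : nat -> R -> R) (x : R) : R :=
  sup (range (fun M => \sum_(k < M) u k x)).

Section moduli.
Context {R : realType}.
Implicit Types (f g w : R -> R) (u : nat -> R -> R).

Lemma weight_modulus w : weight w -> modulus w.
Proof.
case=> w_ge0 w_homo _ w0 w_sub _ _; exact: Modulus.
Qed.

Lemma modulus_ln1p : modulus (fun t : R => ln (1 + t)).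
Proof.
split => [x x0|x y x0 xy||x y x0 y0].
- by rewrite ln_ge0// lerDl.
- by rewrite ler_ln ?posrE; lra.
- by rewrite addr0 ln1.
- rewrite -lnM ?posrE; [|lra|lra].
  rewrite ler_ln ?posrE; [|lra|nra].
  nra.
Qed.

Lemma sublinear_ln1p : sublinear (fun t : R => ln (1 + t)).
Proof.
(* log(1 + t) = log(e (1 + t)) - log e <= e (1 + t) - 1 - log e *)
move=> e e0; exists (e + `|ln e|); first by rewrite addr_ge0// ltW.
move=> t t0; have -> : 1 + t = (e * (1 + t)) * e^-1 by field; rewrite gt_eqF.
have et0 : 0 < e * (1 + t) by rewrite mulr_gt0//; lra.
rewrite lnM ?posrE ?invr_gt0// lnV ?posrE//.
have := @le_ln1Dx R (e * (1 + t) - 1) ltac:(lra).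
rewrite (_ : 1 + (e * (1 + t) - 1) = e * (1 + t)); last by ring.
have := ler_norm (- ln e); rewrite normrN; lra.
Qed.

Lemma modulus_natmul f n t : modulus f -> 0 <= t -> f (t *+ n) <= f t *+ n.
Proof.
move=> mf t0; elim: n => [|n IH]; first by rewrite !mulr0n (modulus0 mf).
rewrite !mulrS (le_trans (modulus_subadditive mf _ _))// ?mulrn_wge0//.
by rewrite lerD2l.
Qed.

(** Subadditivity transports a linear bound at 0 to every point, with
    f(y) - f(x) <= f(y - x) <= L (y - x). *)
Lemma modulus_continuous f (L : R) : modulus f ->
  (forall x, 0 <= x -> f x <= L * x) -> {within `[0, +oo[, continuous f}.
Proof.
move=> mf fL; have L0 : 0 <= L.
  by have := fL 1 ler01; have := modulus_ge0 mf (@ler01 R); lra.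
have lip x y : 0 <= x -> x <= y -> `|f x - f y| <= L * `|x - y|.
  move=> x0 xy; rewrite !ler0_norm ?subr_le0 ?(modulus_nondecreasing mf)//.
  have yx : 0 <= y - x by lra.
  have := modulus_subadditive mf x0 yx; rewrite subrKC.
  have := fL _ yx; lra.
apply/subspace_continuousP => x; rewrite /= in_itv/= andbT => x0.
apply/cvgrPdist_le => e e0; rewrite near_withinE; near=> y.
rewrite /= in_itv/= andbT => y0.
have xy : `|x - y| <= e / (L + 1).
  near: y; have eL : 0 < e / (L + 1) by rewrite divr_gt0//; lra.
  by apply/nbhs_normP; exists (e / (L + 1)) => // z /ltW.
have Lxy : L * `|x - y| <= e.
  apply: (@le_trans _ _ ((L + 1) * `|x - y|));
    first by rewrite ler_wpM2r//; lra.
  by rewrite mulrC -ler_pdivlMr//; lra.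
apply: le_trans Lxy; have [xley|/ltW ylex] := leP x y; first exact: lip.
by rewrite distrC (distrC x); exact: lip.
Unshelve. all: by end_near. Qed.

(** Monotonicity suffices; it is only known on the half-line, so f is first
    composed with the positive part. *)
Lemma modulus_measurable f (D : set R) : modulus f -> measurable D ->
  D `<=` `[0, +oo[ -> measurable_fun D f.
Proof.
move=> mf mD D0.
apply: (@eq_measurable_fun _ _ _ _ D (fun x => f (Num.max 0 x))).
  by move=> x /set_mem/D0 /=; rewrite in_itv/= andbT => x0; rewrite max_r.
apply: nondecreasing_measurable => // x y xy.
apply: modulus_nondecreasing => //; first by rewrite le_max lexx.
by rewrite ge_max !le_max lexx xy orbT.
Qed.

(** * The Lipschitz envelope *)

Section lip_env.
Variables (f : R -> R) (e : R).
Hypotheses (mf : modulus f) (e0 : 0 <= e).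

Lemma lip_env_le x s : 0 <= s <= x -> lip_env f e x <= f s + e * (x - s).
Proof.
move=> /andP[s0 sx]; apply: ge_inf; last first.
  by exists s => //=; rewrite in_itv/=; exact/andP.
exists 0 => z [r /=]; rewrite in_itv/= => /andP[r0 rx] <-.
by rewrite addr_ge0 ?(modulus_ge0 mf)// mulr_ge0 ?subr_ge0.
Qed.

Lemma le_lip_env x m : 0 <= x ->
  (forall s, 0 <= s <= x -> m <= f s + e * (x - s)) -> m <= lip_env f e x.
Proof.
move=> x0 h; apply: lb_le_inf.
  by exists (f 0 + e * (x - 0)), 0 => //=; rewrite in_itv/= lexx.
by move=> z [s /=]; rewrite in_itv/= => /h + <-.
Qed.

Lemma lip_env_le_modulus x : 0 <= x -> lip_env f e x <= f x.
Proof.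
move=> x0; have := @lip_env_le x x; rewrite subrr mulr0 addr0; apply.
by rewrite x0 /=.
Qed.

Lemma lip_env_le_linear x : 0 <= x -> lip_env f e x <= e * x.
Proof.
move=> x0; have := @lip_env_le x 0; rewrite (modulus0 mf) add0r subr0; apply.
by rewrite lexx.
Qed.

(** For subadditivity, near-optimal splittings s of x and t of y combine into the
    splitting s + t of x + y. *)
Lemma modulus_lip_env : modulus (lip_env f e).
Proof.
have ge0 x : 0 <= x -> 0 <= lip_env f e x.
  move=> x0; apply: le_lip_env => // s /andP[s0 sx].
  by rewrite addr_ge0 ?(modulus_ge0 mf)// mulr_ge0 ?subr_ge0.
split => //.
- move=> x y x0 xy; apply: le_lip_env => [|s /andP[s0 sy]]; first lra.
  have [sx|xs] := leP s x.
    apply: le_trans (lip_env_le _) _; first exact/andP/(conj s0 sx).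
    by rewrite lerD2l ler_wpM2l// lerB.
  apply: (le_trans (lip_env_le_modulus x0)).
  apply: (le_trans (modulus_nondecreasing mf x0 (ltW xs))).
  by rewrite lerDl mulr_ge0 ?subr_ge0.
- apply/eqP; rewrite eq_le ge0// andbT.
  by rewrite (le_trans (lip_env_le_modulus _))// (modulus0 mf).
- move=> x y x0 y0.
  (* take the infimum over t, then the one over s *)
  rewrite -lerBlDl; apply: le_lip_env => // t /andP[t0 ty].
  rewrite lerBlDl -lerBlDr; apply: le_lip_env => // s /andP[s0 sx].
  rewrite lerBlDr.
  have -> : f s + e * (x - s) + (f t + e * (y - t)) =
    f s + f t + e * (x + y - (s + t)) by ring.
  apply: le_trans (@lip_env_le _ (s + t) _) _; first by lra.
  by rewrite lerD2r (modulus_subadditive mf).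
Qed.

(** Lowering the slope costs only a bounded amount:
    f(x) <= f(s) + f(x - s) <= f(s) + C + e (x - s). *)
Lemma lip_env_ge C x : (forall t, 0 <= t -> f t <= C + e * t) -> 0 <= x ->
  f x - C <= lip_env f e x.
Proof.
move=> fC x0; apply: le_lip_env => // s /andP[s0 sx].
have xs : 0 <= x - s by lra.
have := modulus_subadditive mf s0 xs; rewrite subrKC.
have := fC _ xs; lra.
Qed.

End lip_env.

(** * Series of moduli *)

Lemma sum_half (M : nat) : \sum_(k < M) 2^-1 ^+ k.+1 = 1 - 2^-1 ^+ M :> R.
Proof.
elim: M => [|M IH]; first by rewrite big_ord0 expr0 subrr.
by rewrite big_ord_recr/= IH !exprS; lra.
Qed.

Section sup_sum.
Variable u : nat -> R -> R.
Hypotheses (mu : forall k, modulus (u k))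
           (u_lin : forall k x, 0 <= x -> u k x <= 2^-1 ^+ k.+1 * x).

Lemma partial_sum_le_id x M : 0 <= x -> \sum_(k < M) u k x <= x.
Proof.
move=> x0; apply: (@le_trans _ _ (\sum_(k < M) 2^-1 ^+ k.+1 * x)).
  by apply: ler_sum => k _; exact: u_lin.
by rewrite -mulr_suml sum_half ler_piMl// gerBl exprn_ge0.
Qed.

Lemma partial_sum_homo x : 0 <= x ->
  {homo (fun M => \sum_(k < M) u k x) : n m / (n <= m)%N >-> n <= m}.
Proof.
move=> x0; apply/nondecreasing_seqP => n.
by rewrite big_ord_recr/= lerDl (modulus_ge0 (mu n)).
Qed.

Lemma has_ubound_partial_sum x : 0 <= x ->
  has_ubound (range (fun M => \sum_(k < M) u k x)).
Proof. by move=> x0; exists x => _ [M _ <-]; exact: partial_sum_le_id. Qed.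

Lemma partial_sum_le x M : 0 <= x -> \sum_(k < M) u k x <= sup_sum u x.
Proof.
by move=> x0; apply: ub_le_sup; [exact: has_ubound_partial_sum|exists M].
Qed.

Lemma sup_sum_le x B : (forall M, \sum_(k < M) u k x <= B) -> sup_sum u x <= B.
Proof.
by move=> h; apply: ge_sup => [|_ [M _ <-]//]; exists (\sum_(k < 0) u k x), 0%N.
Qed.

Lemma sup_sum_le_id x : 0 <= x -> sup_sum u x <= x.
Proof. by move=> x0; apply: sup_sum_le => M; exact: partial_sum_le_id. Qed.

Lemma modulus_sup_sum : modulus (sup_sum u).
Proof.
have ge0 x : 0 <= x -> 0 <= sup_sum u x.
  by move=> x0; have := partial_sum_le 0 x0; rewrite big_ord0.
split => //.
- move=> x y x0 xy; apply: sup_sum_le => M.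
  apply: le_trans (partial_sum_le M (le_trans x0 xy)).
  by apply: ler_sum => k _; exact: (modulus_nondecreasing (mu k)).
- by apply/eqP; rewrite eq_le ge0// andbT sup_sum_le_id.
- move=> x y x0 y0; apply: sup_sum_le => M.
  apply: le_trans (lerD (partial_sum_le M x0) (partial_sum_le M y0)).
  rewrite -big_split/=.
  by apply: ler_sum => k _; exact: (modulus_subadditive (mu k)).
Qed.

End sup_sum.

(** * The integral condition *)

(** The (non-quasianalyticity) integral whose finiteness is required of
    weights. *)
Definition nqa_integral (f : R -> R) : \bar R :=
  (\int[@lebesgue_measure R]_(t in `[1%R, +oo[) (f t / t ^+ 2)%:E)%E.

Lemma measurable_div_sqr f : measurable_fun (`[1%R, +oo[ : set R) f ->
  measurable_fun (`[1%R, +oo[ : set R) (fun t => (f t / t ^+ 2)%:E).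
Proof.
move=> mf; apply/measurable_EFinP/measurable_funM => //.
(* a function that agrees with t^-2 on [1, oo) and is monotone on all of R *)
apply: (@eq_measurable_fun _ _ _ _ _ (fun t : R => (Num.max 1 t ^+ 2)^-1)).
  by move=> t /set_mem /=; rewrite in_itv/= andbT => t1; rewrite max_r.
have max0 (t : R) : 0 < Num.max 1 t by rewrite lt_max ltr01.
apply: nonincreasing_measurable => // s t st.
rewrite lef_pV2 ?posrE ?exprn_gt0// lerXn2r ?nnegrE ?(ltW (max0 _))//.
by rewrite ge_max !le_max lexx st orbT.
Qed.

Lemma div_sqr_ge0 (a t : R) : 0 <= a -> (0 <= (a / t ^+ 2)%:E)%E.
Proof. by move=> a0; rewrite lee_fin mulr_ge0// invr_ge0 sqr_ge0. Qed.

Lemma modulus_measurable_div_sqr f : modulus f ->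
  measurable_fun (`[1%R, +oo[ : set R) (fun t => (f t / t ^+ 2)%:E).
Proof.
move=> mf; apply: measurable_div_sqr; apply: modulus_measurable => // t /=.
by rewrite !in_itv/= !andbT; apply: le_trans.
Qed.

Lemma nqa_integral_le f g : modulus f -> modulus g ->
  (forall t, 1 <= t -> f t <= g t) -> (nqa_integral f <= nqa_integral g)%E.
Proof.
move=> mf mg fg; apply: ge0_le_integral => //.
- move=> t /=; rewrite in_itv/= andbT => t1.
  by apply/div_sqr_ge0/(modulus_ge0 mf)/(le_trans _ t1).
- exact: modulus_measurable_div_sqr.
- exact: modulus_measurable_div_sqr.
- move=> t /=; rewrite in_itv/= andbT => t1.
  by rewrite lee_fin ler_wpM2r ?fg// invr_ge0 sqr_ge0.
Qed.

Lemma nqa_integralD f g : modulus f -> modulus g ->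
  nqa_integral (fun t => f t + g t) = (nqa_integral f + nqa_integral g)%E.
Proof.
move=> mf mg; rewrite /nqa_integral -ge0_integralD//.
- by apply: eq_integral => t _; rewrite mulrDl EFinD.
- move=> t /=; rewrite in_itv/= andbT => t1.
  by apply/div_sqr_ge0/(modulus_ge0 mf)/(le_trans _ t1).
- exact: modulus_measurable_div_sqr.
- move=> t /=; rewrite in_itv/= andbT => t1.
  by apply/div_sqr_ge0/(modulus_ge0 mg)/(le_trans _ t1).
- exact: modulus_measurable_div_sqr.
Qed.

Lemma nqa_integralZ f (c : R) : modulus f -> 0 <= c ->
  nqa_integral (fun t => c * f t) = (c%:E * nqa_integral f)%E.
Proof.
move=> mf c0; rewrite /nqa_integral -ge0_integralZl_EFin//.
- by apply: eq_integral => t _; rewrite -mulrA EFinM.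
- move=> t /=; rewrite in_itv/= andbT => t1.
  by apply/div_sqr_ge0/(modulus_ge0 mf)/(le_trans _ t1).
- exact: modulus_measurable_div_sqr.
Qed.

Lemma modulusD f g : modulus f -> modulus g -> modulus (fun t => f t + g t).
Proof.
move=> mf mg; split.
- by move=> x x0; rewrite addr_ge0 ?(modulus_ge0 mf) ?(modulus_ge0 mg).
- move=> x y x0 xy.
  by rewrite lerD ?(modulus_nondecreasing mf) ?(modulus_nondecreasing mg).
- by rewrite (modulus0 mf) (modulus0 mg) addr0.
- move=> x y x0 y0; rewrite addrACA.
  by rewrite lerD ?(modulus_subadditive mf) ?(modulus_subadditive mg).
Qed.

Lemma modulusZ f (c : R) : modulus f -> 0 <= c -> modulus (fun t => c * f t).
Proof.
move=> mf c0; split.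
- by move=> x x0; rewrite mulr_ge0 ?(modulus_ge0 mf).
- by move=> x y x0 xy; rewrite ler_wpM2l ?(modulus_nondecreasing mf).
- by rewrite (modulus0 mf) mulr0.
- by move=> x y x0 y0; rewrite -mulrDr ler_wpM2l ?(modulus_subadditive mf).
Qed.

(** Dominated convergence, used twice: for the tails of w in [sublinear_of_nqa],
    and for its envelopes of vanishing slope in [weight_above]. *)
Lemma nqa_integral_dominated w (h : nat -> R -> R) : modulus w ->
  (nqa_integral w < +oo)%E ->
  (forall n, measurable_fun (`[1%R, +oo[ : set R) (h n)) ->
  (forall n t, 1 <= t -> 0 <= h n t <= w t) ->
  (forall t, 1 <= t -> h n t @[n --> \oo] --> 0) ->
  forall d, 0 < d -> \forall n \near \oo, (nqa_integral (h n) <= d%:E)%E.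
Proof.
move=> mw wfin mh hw h0 d d0.
have mI : measurable (`[1%R, +oo[ : set R) by [].
have [|//||||] := @dominated_convergence _ _ R lebesgue_measure _ mI
  (fun n t => (h n t / t ^+ 2)%:E) (fun=> 0%E) (fun t => (w t / t ^+ 2)%:E).
- by move=> n; exact: measurable_div_sqr.
- apply: aeW => t /=; rewrite in_itv/= andbT => t1.
  apply: cvg_EFin; first exact: nearW.
  rewrite -[X in _ --> X](mul0r (t ^+ 2)^-1).
  by apply: cvgMl; exact: h0.
- apply/integrableP; split; first exact: modulus_measurable_div_sqr.
  apply: le_lt_trans wfin; rewrite le_eqVlt; apply/orP; left; apply/eqP.
  apply: eq_integral => t /set_mem/=; rewrite in_itv/= andbT => t1.
  rewrite /= ger0_norm//; apply: mulr_ge0; last by rewrite invr_ge0 sqr_ge0.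
  by apply/(modulus_ge0 mw)/(le_trans _ t1).
- apply: aeW => t n /=; rewrite in_itv/= andbT => t1.
  have /andP[hn0 hnw] := hw n t t1.
  have t20 : 0 <= (t ^+ 2)^-1 by rewrite invr_ge0 sqr_ge0.
  by rewrite lee_fin ger0_norm ?mulr_ge0// ler_wpM2r.
move=> _ _; rewrite integral0 => /fine_cvgP[fin /cvgr0Pnorm_le/(_ d d0) small].
near=> n; have fn : nqa_integral (h n) \is a fin_num by near: n.
rewrite -(fineK fn) lee_fin; apply: le_trans (ler_norm _) _.
by near: n.
Unshelve. all: by end_near. Qed.

(** The integral over [n, 2n] is at most that of the tail of w past n, hence
    tends to 0, and is at least n w(n)/(2n)^2.  So w(n) <= e n for a single
    n >= 1; subadditivity then gives w(t) <= w(n) + e t for all t, since t is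
    covered by 1 + floor(t/n) intervals of length n. *)
Lemma sublinear_of_nqa w : modulus w -> (nqa_integral w < +oo)%E -> sublinear w.
Proof.
move=> mw wfin e e0.
pose h n t := w t * \1_(`[n%:R, +oo[ : set R) t.
have mh n : measurable_fun (`[1%R, +oo[ : set R) (h n).
  apply: measurable_funM; last exact: measurable_indic.
  apply: modulus_measurable => // t /=; rewrite !in_itv/= !andbT.
  exact: le_trans.
have h0 n t : 1 <= t -> 0 <= h n t <= w t.
  move=> t1; have w0 : 0 <= w t by apply: (modulus_ge0 mw); lra.
  by rewrite /h indicE; case: (_ \in _); rewrite ?mulr1 ?mulr0 ?lexx ?w0.
have : \forall n \near \oo, (nqa_integral (h n) <= (e / 4)%:E)%E.
  apply: (nqa_integral_dominated mw wfin) => //; last by rewrite divr_gt0.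
  move=> t t1; apply: (cvg_trans (near_eq_cvg _) (cvg_cst 0)).
  near=> n; rewrite /h indicE memNset ?mulr0//= in_itv/= andbT.
  by apply/negP; rewrite -ltNge; near: n; exact: nbhs_infty_gtr.
move=> /filterI /(_ (nbhs_infty_gt 0)) /(@filter_ex _ _ _) [n [/= In n0]].
have n1 : 1 <= n%:R :> R by rewrite ler1n.
have nR0 : 0 < n%:R :> R by rewrite ltr0n.
have wn0 : 0 <= w n%:R by exact: (modulus_ge0 mw).
have wn : w n%:R <= e * n%:R.
  pose c := w n%:R / (2 * n%:R) ^+ 2.
  pose J := `[n%:R, 2 * n%:R]%classic : set R.
  have mJ : measurable J by exact: measurable_itv.
  have : (c%:E * (n%:R)%:E <= (e / 4)%:E :> \bar R)%E.
    apply: le_trans In.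
    have <- : lebesgue_measure J = n%:R%:E.
      rewrite /J lebesgue_measure_itv/= lte_fin ifT; last lra.
      by rewrite -EFinB; congr EFin; ring.
    rewrite -integral_cst//.
    have sub : J `<=` (`[1%R, +oo[ : set R).
      move=> t; rewrite /J/= !in_itv/= andbT => /andP[nt _].
      exact: le_trans nt.
    apply: (@le_trans _ _
        (\int[@lebesgue_measure R]_(t in J) (h n t / t ^+ 2)%:E)%E).
      apply: ge0_le_integral => //.
      - by move=> t _; rewrite div_sqr_ge0.
      - by apply: measurable_funS (measurable_div_sqr (mh n)).
      - move=> t; rewrite /J/= in_itv/= => /andP[nt t2n].
        rewrite lee_fin /c /h indicE mem_set ?mulr1//=; last first.
          by rewrite in_itv/= andbT.
        apply: ler_pM; rewrite ?invr_ge0 ?sqr_ge0//.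
          by apply: (modulus_nondecreasing mw); lra.
        have t0 : 0 < t by lra.
        have n20 : 0 < 2 * n%:R :> R by lra.
        rewrite lef_pV2 ?posrE ?exprn_gt0//.
        rewrite lerXn2r ?nnegrE ?(ltW t0) ?(ltW n20)//.
    rewrite /nqa_integral; apply: ge0_subset_integral => //;
      first exact: measurable_div_sqr.
    move=> t /=; rewrite in_itv/= andbT => /(h0 n)/andP[ht _].
    exact: div_sqr_ge0.
  rewrite -EFinM lee_fin (_ : c * _ = w n%:R / n%:R / 4).
    by rewrite ler_pM2r// ler_pdivrMr.
  by rewrite /c; field; rewrite gt_eqF.
exists (w n%:R) => // t t0; pose m := Num.truncn (t / n%:R).
have tn0 : 0 <= t / n%:R by rewrite divr_ge0// ltW.
have /andP[mt tm] := truncn_itv tn0; rewrite -/m in mt tm.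
rewrite ler_pdivlMr// in mt; rewrite ltr_pdivrMr// in tm.
have tle : t <= n%:R *+ m.+1 by rewrite -[leRHS]mulr_natl ltW.
apply: (le_trans (modulus_nondecreasing mw t0 tle)).
apply: (le_trans (modulus_natmul _ mw (ltW nR0))).
rewrite mulrS lerD2l -[leLHS]mulr_natl.
apply: (@le_trans _ _ (m%:R * (e * n%:R))); first by rewrite ler_wpM2l.
by rewrite mulrCA ler_pM2l.
Unshelve. all: by end_near. Qed.

(** Monotone convergence along the partial sums, whose integrals are at most
    the sum of 2^-(k+1), that is 1. *)
Lemma nqa_integral_sup_sum u : (forall k, modulus (u k)) ->
  (forall k x, 0 <= x -> u k x <= 2^-1 ^+ k.+1 * x) ->
  (forall k, (nqa_integral (u k) <= (2^-1 ^+ k.+1)%:E)%E) ->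
  (nqa_integral (sup_sum u) < +oo)%E.
Proof.
move=> mu u_lin u_int.
pose g M t : \bar R := ((\sum_(k < M) u k t) / t ^+ 2)%:E.
have mI : measurable (`[1%R, +oo[ : set R) by [].
have pos (t : R) : `[1%R, +oo[%classic t -> 0 <= t.
  by rewrite /= in_itv/= andbT; apply: le_trans.
have gE M : g M = (fun t => \sum_(k < M) (u k t / t ^+ 2)%:E)%E.
  by apply/funext => t; rewrite /g mulr_suml sumEFin.
have g0 M t : `[1%R, +oo[%classic t -> (0 <= g M t)%E.
  move=> /pos t0; rewrite div_sqr_ge0// sumr_ge0// => k _.
  exact: (modulus_ge0 (mu k)).
have mg M : measurable_fun (`[1%R, +oo[ : set R) (g M).
  by rewrite gE; apply: emeasurable_sum => k; exact: modulus_measurable_div_sqr.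
have homo t : `[1%R, +oo[%classic t ->
    {homo g^~ t : n m / (n <= m)%N >-> (n <= m)%E}.
  move=> /pos t0 n m nm; rewrite lee_fin ler_wpM2r ?invr_ge0 ?sqr_ge0//.
  exact: (partial_sum_homo mu).
have le1 M : (\int[@lebesgue_measure R]_(t in `[1%R, +oo[) g M t <= 1)%E.
  rewrite gE ge0_integral_sum//; last 2 first.
  - by move=> k; exact: modulus_measurable_div_sqr.
  - by move=> k t /pos t0; rewrite div_sqr_ge0// (modulus_ge0 (mu k)).
  apply: (@le_trans _ _ (\sum_(k < M) (2^-1 ^+ k.+1 : R)%:E)%E).
    by apply: lee_sum => k _; exact: u_int.
  by rewrite sumEFin sum_half lee_fin gerBl exprn_ge0.
have limE : (\int[@lebesgue_measure R]_(t in `[1%R, +oo[) limn (g^~ t))%E =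
    nqa_integral (sup_sum u).
  apply: eq_integral => t /set_mem /pos t0; apply/cvg_lim => //.
  apply: cvg_EFin; first exact: nearW.
  apply: cvgMl; apply: nondecreasing_cvgn; first exact: (partial_sum_homo mu).
  exact: has_ubound_partial_sum.
apply: (@le_lt_trans _ _ 1%E); last exact: ltry.
have le : (\int[@lebesgue_measure R]_(t in `[1%R, +oo[) g M t)%E @[M --> \oo]
    --> nqa_integral (sup_sum u).
  by rewrite -limE; exact: cvg_monotone_convergence.
by apply: cvge_le le; exact: nearW.
Qed.

(** * Comparison at infinity *)

Lemma ln1p_infty : (fun t : R => ln (1 + t)) @ +oo --> +oo.
Proof.
apply/cvgryPge => A; near=> t.
have tA : expR A <= t by near: t; exact: nbhs_pinfty_ge.
rewrite -ler_expR lnK ?posrE; have := expR_gt0 A; lra.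
Unshelve. all: by end_near. Qed.

Lemma ll_trans f g h : f ≪ g -> g ≪ h -> f ≪ h.
Proof.
move=> /llP fg /llP gh; apply/llP => e e0; near=> t.
apply: (@le_trans _ _ `|g t|); last by near: t; exact: gh.
by rewrite -[leRHS]mul1r; near: t; exact: fg.
Unshelve. all: by end_near. Qed.

Lemma le_ll f g h : (forall t, 0 <= t -> 0 <= f t <= g t) -> g ≪ h -> f ≪ h.
Proof.
move=> fg /llP gh; apply/llP => e e0; near=> t.
apply: (@le_trans _ _ `|g t|); last by near: t; exact: gh.
have /fg/andP[f0 ftg] : 0 <= t by near: t; exact: nbhs_pinfty_ge.
by rewrite !ger0_norm// (le_trans f0).
Unshelve. all: by end_near. Qed.

Lemma weight_ll_ln1p w : weight w -> (fun t => ln (1 + t)) ≪ w.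
Proof.
move=> ww; apply/llP => e e0; near=> t.
have t0 : 0 < t by near: t; exact: nbhs_pinfty_gt.
have lnt : 0 < ln (1 + t) by rewrite ln_gt0//; lra.
have wt : e^-1 <= w t / ln (1 + t).
  by near: t; move/cvgryPge: (weight_ln ww); exact.
rewrite !ger0_norm ?(ltW lnt) ?(weight_ge0 ww) ?(ltW t0)//.
by rewrite -ler_pdivrMl// -ler_pdivlMr.
Unshelve. all: by end_near. Qed.

Lemma ll_infty f w : modulus w -> f ≪ w ->
  f t @[t --> +oo] --> +oo -> w t @[t --> +oo] --> +oo.
Proof.
move=> mw /llP fw /cvgryPge f_oo; apply/cvgryPge => A; near=> t.
have t0 : 0 <= t by near: t; exact: nbhs_pinfty_ge.
rewrite -[w t]ger0_norm ?(modulus_ge0 mw)// -[leRHS]mul1r.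
apply: (@le_trans _ _ `|f t|); last by near: t; exact: fw.
by apply: le_trans (ler_norm _); near: t; exact: f_oo.
Unshelve. all: by end_near. Qed.

(** The bound F(x) <= x yields continuity; growth beyond the logarithm is stated
    as a comparison so that it can be obtained by transitivity. *)
Lemma modulus_weight (F : R -> R) : modulus F ->
  (forall x, 0 <= x -> F x <= x) ->
  (nqa_integral F < +oo)%E -> (fun t => ln (1 + t)) ≪ F -> weight F.
Proof.
move=> mF Fle Fint /llP lnF; split => //.
- exact: modulus_ge0.
- exact: modulus_nondecreasing.
- by apply: (modulus_continuous (L := 1)) => // x x0; rewrite mul1r Fle.
- exact: modulus0.
- exact: modulus_subadditive.
- apply/cvgryPge => A.
  pose B := `|A| + 1; have B0 : 0 < B by rewrite ltr_wpDl.
  near=> t.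
  have t0 : 0 < t by near: t; exact: nbhs_pinfty_gt.
  have lnt : 0 < ln (1 + t) by rewrite ln_gt0//; lra.
  have : `|ln (1 + t)| <= B^-1 * `|F t|.
    by near: t; apply: lnF; rewrite invr_gt0.
  rewrite !ger0_norm ?(ltW lnt) ?(modulus_ge0 mF) ?(ltW t0)// => h.
  rewrite ler_pdivlMr//; apply: (@le_trans _ _ (B * ln (1 + t))).
    by rewrite ler_wpM2r ?(ltW lnt)// /B (le_trans (ler_norm A))// lerDl.
  by rewrite -ler_pdivlMl.
Unshelve. all: by end_near. Qed.

(** * Sums of delayed copies *)

Section lip_env_sum.
Variables (f : R -> R) (eps : nat -> R).
Hypotheses (mf : modulus f) (f_sub : sublinear f)
  (f_oo : f t @[t --> +oo] --> +oo)
  (eps_gt0 : forall k, 0 < eps k) (eps_le : forall k, eps k <= 2^-1 ^+ k.+1).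

Let u k := lip_env f (eps k).

Lemma modulus_lip_env_term k : modulus (u k).
Proof. exact/modulus_lip_env/ltW. Qed.

Lemma lip_env_term_le k x : 0 <= x -> u k x <= 2^-1 ^+ k.+1 * x.
Proof.
move=> x0; apply: (le_trans (lip_env_le_linear mf (ltW (eps_gt0 k)) x0)).
by rewrite ler_wpM2r.
Qed.

Lemma modulus_lip_env_sum : modulus (sup_sum u).
Proof.
exact: modulus_sup_sum modulus_lip_env_term lip_env_term_le.
Qed.

Lemma lip_env_sum_le_id x : 0 <= x -> sup_sum u x <= x.
Proof. exact: sup_sum_le_id lip_env_term_le _. Qed.

(** Each of the first N terms is f up to a constant. *)
Lemma lip_env_sum_ge N : exists C, forall t, 0 <= t ->
  N%:R * f t - C <= sup_sum u t.
Proof.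
suff [C h] : exists C, forall t, 0 <= t -> N%:R * f t - C <= \sum_(k < N) u k t.
  exists C => t t0; apply: le_trans (h _ t0) _.
  exact: (partial_sum_le lip_env_term_le).
elim: N => [|N [C IH]].
  by exists 0 => t t0; rewrite big_ord0 mul0r subr0.
have [D _ hD] := f_sub (eps_gt0 N).
exists (C + D) => t t0; rewrite big_ord_recr/= -natr1.
have := lip_env_ge mf hD t0; have := IH _ t0; rewrite -/(u N); lra.
Qed.

(** With N > 2/e, e F >= 2 f - e C, and f absorbs the constant e C as it tends to
    infinity. *)
Lemma ll_lip_env_sum : f ≪ sup_sum u.
Proof.
move/cvgryPge: f_oo => f_ge; apply/llP => e e0.
have [C hC] := lip_env_sum_ge (Num.truncn (2 / e)).+1.
near=> t.
have t0 : 0 <= t by near: t; exact: nbhs_pinfty_ge.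
have ft0 := modulus_ge0 mf t0.
rewrite !ger0_norm ?(modulus_ge0 modulus_lip_env_sum)//.
have ftC : e * C <= f t by near: t; exact: f_ge.
have := hC _ t0; rewrite -(ler_pM2l e0) mulrBr; apply: le_trans.
have eN : 0 <= e * (Num.truncn (2 / e)).+1%:R - 2.
  by rewrite subr_ge0 mulrC -ler_pdivrMr// ltW// truncnS_gt.
have := mulr_ge0 eN ft0; lra.
Unshelve. all: by end_near. Qed.

End lip_env_sum.

(** * Weights above a modulus and between two moduli *)

(** As e tends to 0, the envelope of slope e is dominated by f and tends to 0
    pointwise, so slopes e_k can be chosen whose envelopes have integral at most
    2^-(k+1).  As f is only assumed to be a modulus, the lemma also applies to
    the sum of two weights. *)
Lemma weight_above f : modulus f -> (nqa_integral f < +oo)%E ->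
  (fun t => ln (1 + t)) ≪ f -> exists2 g, weight g & f ≪ g.
Proof.
move=> mf fint lnf; have f_sub := sublinear_of_nqa mf fint.
have f_oo := ll_infty mf lnf ln1p_infty.
have half0 k : 0 < 2^-1 ^+ k.+1 :> R by rewrite exprn_gt0.
have small k : exists e, [/\ 0 < e, e <= 2^-1 ^+ k.+1 :> R &
    (nqa_integral (lip_env f e) <= (2^-1 ^+ k.+1)%:E)%E].
  have hpos n : 0 < @harmonic R n by rewrite /= invr_gt0.
  have hge0 n := ltW (hpos n).
  have mlip n : modulus (lip_env f (@harmonic R n)) by exact: modulus_lip_env.
  have : \forall n \near \oo,
      (nqa_integral (lip_env f (harmonic n)) <= (2^-1 ^+ k.+1)%:E)%E.
    apply: (nqa_integral_dominated mf fint) => //.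
    - move=> n; apply: modulus_measurable => // t /=; rewrite !in_itv/= !andbT.
      exact: le_trans.
    - move=> n t t1; have t0 : 0 <= t by lra.
      by rewrite (modulus_ge0 (mlip n))// lip_env_le_modulus.
    - move=> t t1; have t0 : 0 <= t by lra.
      apply: (@squeeze_cvgr _ _ _ _ (fun=> 0) (fun n => harmonic n * t)).
      + apply: nearW => n.
        by rewrite (modulus_ge0 (mlip n))// lip_env_le_linear.
      + exact: cvg_cst.
      + by rewrite -(mul0r t); apply: cvgMl; exact: cvg_harmonic.
  have /cvgr0Pnorm_le/(_ _ (half0 k)) := @cvg_harmonic R.
  move=> /filterI h /h /(@filter_ex _ _ _) [n [/= hn In]].
  exists (harmonic n); split => //; exact: le_trans (ler_norm _) hn.
have [eps heps] := choice small.
have eps0 k : 0 < eps k by case: (heps k).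
have eps_le k : eps k <= 2^-1 ^+ k.+1 by case: (heps k).
exists (sup_sum (fun k => lip_env f (eps k))); last exact: ll_lip_env_sum.
apply: modulus_weight.
- exact: modulus_lip_env_sum.
- exact: lip_env_sum_le_id.
- apply: nqa_integral_sup_sum => k.
  + exact: modulus_lip_env_term.
  + exact: lip_env_term_le.
  + by case: (heps k).
- exact: ll_trans lnf (ll_lip_env_sum _ _ _ _ _).
Qed.

(** The relation F = o(w) bounds F by w only far out.  Nearer, F is bounded and w
    is bounded below by w(1), which is positive since w(n) <= n w(1) and w is
    unbounded; so F <= K w on all of [1, oo). *)
Lemma nqa_integral_ll (F : R -> R) w : modulus F -> modulus w ->
  w t @[t --> +oo] --> +oo -> F ≪ w ->
  (nqa_integral w < +oo)%E -> (nqa_integral F < +oo)%E.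
Proof.
move=> mF mw /cvgryPge w_oo /llP Fw wint.
have w1 : 0 < w 1.
  have [t [wt t0]] : exists t, 1 <= w t /\ 0 <= t.
    near (pinfty_nbhs R) => t; exists t; split; near: t; first exact: w_oo.
    exact: nbhs_pinfty_ge.
  have tn := ltW (truncnS_gt t).
  have := modulus_nondecreasing mw t0 tn.
  have := modulus_natmul (Num.truncn t).+1 mw ler01.
  have [//|w1 w1n] := ltP 0 (w 1).
  have := mulrn_wle0 (Num.truncn t).+1 w1; lra.
have [T [T1 FwT]] : exists T, 1 <= T /\ forall t, T <= t -> F t <= w t.
  have [M [_ hM]] := Fw 1 ltr01.
  exists (Num.max 1 (M + 1)); split; first by rewrite le_max lexx.
  move=> t; rewrite ge_max => /andP[t1 Mt].
  have t0 : 0 <= t by lra.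
  have := hM t ltac:(lra).
  by rewrite mul1r !ger0_norm ?(modulus_ge0 mF) ?(modulus_ge0 mw).
have T0 : 0 <= T by lra.
pose K := 1 + F T / w 1.
have FT0 : 0 <= F T / w 1 by rewrite divr_ge0 ?(modulus_ge0 mF)// ltW.
have K0 : 0 <= K by rewrite addr_ge0.
apply: (@le_lt_trans _ _ (nqa_integral (fun t => K * w t))).
  apply: nqa_integral_le => //; first exact: modulusZ.
  move=> t t1; have t0 : 0 <= t by lra.
  have wt0 := modulus_ge0 mw t0.
  have w1t : w 1 <= w t by exact: (modulus_nondecreasing mw).
  rewrite /K mulrDl mul1r; have [Tt|/ltW tT] := leP T t.
    by apply: (le_trans (FwT _ Tt)); rewrite lerDl mulr_ge0.
  apply: (le_trans (modulus_nondecreasing mF t0 tT)).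
  have -> : F T = F T / w 1 * w 1 by rewrite divfK ?gt_eqF.
  rewrite mulfK ?gt_eqF//.
  by rewrite (le_trans (ler_wpM2l FT0 w1t))// lerDr.
by rewrite nqa_integralZ// lte_mul_pinfty.
Unshelve. all: by end_near. Qed.

(** If f <= 2^-(k+1) w past T, the envelope of slope 2^-(k+1)/T is at most
    2^-(k+1) (1 + w): before T by its linear bound, after T because it is at most
    f.  Bounding the first N terms by f and the others this way gives
    F <= N f + 2^-N (1 + w), where N f = o(w) for each N, and the second summand
    is at most 2^(1-N) w once w >= 1. *)
Lemma modulus_between f w : modulus f -> sublinear f ->
  f t @[t --> +oo] --> +oo ->
  modulus w -> (nqa_integral w < +oo)%E -> f ≪ w ->
  exists F, [/\ modulus F, forall x, 0 <= x -> F x <= x,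
                (nqa_integral F < +oo)%E, f ≪ F & F ≪ w].
Proof.
move=> mf f_sub f_oo mw wint fw; have /llP fwP := fw.
have w_oo := ll_infty mw fw f_oo; have /cvgryPge w_ge := w_oo.
have half0 k : 0 < 2^-1 ^+ k.+1 :> R by rewrite exprn_gt0.
have small k : exists e, [/\ 0 < e, e <= 2^-1 ^+ k.+1 :> R &
    forall x, 0 <= x -> lip_env f e x <= 2^-1 ^+ k.+1 * (1 + w x)].
  have [M [_ hM]] := fwP _ (half0 k).
  pose T := Num.max 1 (M + 1).
  have T1 : 1 <= T by rewrite le_max lexx.
  have MT : M + 1 <= T by rewrite le_max lexx orbT.
  have T0 : 0 < T by lra.
  have e0 : 0 < 2^-1 ^+ k.+1 / T by rewrite divr_gt0.
  exists (2^-1 ^+ k.+1 / T); split => //.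
    by rewrite ler_pdivrMr// ler_peMr// ltW.
  move=> x x0; have wx0 := modulus_ge0 mw x0.
  rewrite mulrDr mulr1; have [xT|Tx] := leP x T.
    apply: (le_trans (lip_env_le_linear mf (ltW e0) x0)).
    apply: (@le_trans _ _ (2^-1 ^+ k.+1)); last by rewrite lerDl mulr_ge0// ltW.
    by rewrite mulrAC ler_pdivrMr// ler_pM2l.
  apply: (le_trans (lip_env_le_modulus mf (ltW e0) x0)).
  have := hM x ltac:(lra); rewrite !ger0_norm ?(modulus_ge0 mf)//.
  move=> /le_trans; apply.
  by rewrite lerDr ltW.
have [eps heps] := choice small.
have eps0 k : 0 < eps k by case: (heps k).
have eps_le k : eps k <= 2^-1 ^+ k.+1 by case: (heps k).
pose u k := lip_env f (eps k).
have mu k : modulus (u k) by exact: modulus_lip_env_term.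
have mF : modulus (sup_sum u) by exact: modulus_lip_env_sum.
have F_le N x : 0 <= x ->
    sup_sum u x <= N%:R * f x + 2^-1 ^+ N * (1 + w x).
  move=> x0; have wx0 := modulus_ge0 mw x0.
  have fx0 := modulus_ge0 mf x0.
  have head : \sum_(k < N) u k x <= N%:R * f x.
    rewrite mulr_natl -[X in _ *+ X]card_ord -sumr_const.
    by apply: ler_sum => k _; exact: (lip_env_le_modulus mf (ltW (eps0 k))).
  have tail M : \sum_(k < N + M) u k x <=
      N%:R * f x + (2^-1 ^+ N - 2^-1 ^+ (N + M)) * (1 + w x).
    elim: M => [|M IH]; first by rewrite addn0 subrr mul0r addr0.
    rewrite addnS big_ord_recr/=.
    have [_ _ /(_ _ x0)] := heps (N + M)%N; rewrite -/(u _) => uNM.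
    apply: (le_trans (lerD IH uNM)).
    rewrite exprS; lra.
  apply: sup_sum_le => M.
  apply: (le_trans (partial_sum_homo mu x0 (leq_addl N M))).
  apply: (le_trans (tail M)); rewrite lerD2l ler_wpM2r ?addr_ge0//.
  by rewrite gerBl exprn_ge0.
have Fw : sup_sum u ≪ w.
  apply/llP => d d0.
  have [N hN] : exists N, 2^-1 ^+ N <= d / 4 :> R.
    have /cvgr0Pnorm_le/(_ (d / 4)) : 2^-1 ^+ n @[n --> \oo] --> (0 : R).
      by apply: cvg_expr; rewrite ger0_norm//; lra.
    move=> /(_ ltac:(lra))/(@filter_ex _ _ _)[N /= hN].
    by exists N; exact: le_trans (ler_norm _) hN.
  (* d/4 bounds N f / w, and d/2 bounds 2^-N (1 + w) / w as soon as w >= 1; the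
     successor avoids a division by 0 *)
  have dN : 0 < d / 4 / N.+1%:R by rewrite !divr_gt0.
  near=> x.
  have x0 : 0 <= x by near: x; exact: nbhs_pinfty_ge.
  have fx0 := modulus_ge0 mf x0.
  have w1 : 1 <= w x by near: x; exact: w_ge.
  have : `|f x| <= d / 4 / N.+1%:R * `|w x| by near: x; exact: fwP.
  rewrite !ger0_norm ?(modulus_ge0 mF) ?(modulus_ge0 mw)// => fwx.
  apply: (le_trans (F_le N _ x0)).
  have : N%:R * f x <= d / 4 * w x.
    apply: (@le_trans _ _ (N.+1%:R * f x)).
      by rewrite ler_wpM2r// ler_nat.
    by rewrite mulrC -ler_pdivlMr// mulrAC.
  have : 2^-1 ^+ N * (1 + w x) <= d / 4 * (2 * w x).
    by apply: ler_pM; rewrite ?exprn_ge0//; lra.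
  nra.
exists (sup_sum u); split => //.
- exact: lip_env_sum_le_id.
- exact: nqa_integral_ll wint.
- exact: ll_lip_env_sum.
Unshelve. all: by end_near. Qed.

End moduli.

Theorem theorem2p4 (R : realType) :
  [/\ (forall w : R -> R, weight w -> exists w' : R -> R, weight w' /\ w ≪ w'),
      (forall w : R -> R, weight w -> exists w1 : R -> R, weight w1 /\ w1 ≪ w),
      (forall w1 w2 : R -> R, weight w1 -> weight w2 -> w1 ≪ w2 ->
         exists w3 : R -> R, [/\ weight w3, w1 ≪ w3 & w3 ≪ w2]) &
      (forall w1 w2 : R -> R, weight w1 -> weight w2 ->
         exists w3 : R -> R, [/\ weight w3, w1 ≪ w3 & w2 ≪ w3])].
Proof.
have mod := @weight_modulus R; have int := @weight_integral R.
split.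
- move=> w ww.
  have [w' ww' ww'w] := weight_above (mod _ ww) (int _ ww) (weight_ll_ln1p ww).
  by exists w'.
- move=> w ww.
  have [F [mF Fid Fint lnF Fw]] := modulus_between modulus_ln1p
    sublinear_ln1p ln1p_infty (mod _ ww) (int _ ww) (weight_ll_ln1p ww).
  by exists F; split => //; exact: modulus_weight.
- move=> w1 w2 ww1 ww2 w12.
  have ln1 := weight_ll_ln1p ww1; have m1 := mod _ ww1.
  have [F [mF Fid Fint w1F Fw]] := modulus_between m1
    (sublinear_of_nqa m1 (int _ ww1)) (ll_infty m1 ln1 ln1p_infty)
    (mod _ ww2) (int _ ww2) w12.
  exists F; split => //; apply: modulus_weight => //; exact: ll_trans w1F.
- move=> w1 w2 ww1 ww2.
  have m1 := mod _ ww1; have m2 := mod _ ww2.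
  have le1 t : 0 <= t -> 0 <= w1 t <= w1 t + w2 t.
    by move=> t0; rewrite (modulus_ge0 m1)//= lerDl (modulus_ge0 m2).
  have le2 t : 0 <= t -> 0 <= w2 t <= w1 t + w2 t.
    by move=> t0; rewrite (modulus_ge0 m2)//= lerDr (modulus_ge0 m1).
  have [] := @weight_above R (fun t => w1 t + w2 t).
  + exact: modulusD.
  + by rewrite nqa_integralD//; exact: lte_add_pinfty (int _ ww1) (int _ ww2).
  + have /llP ln1 := weight_ll_ln1p ww1.
    apply/llP => e e0; near=> t.
    have t0 : 0 <= t by near: t; exact: nbhs_pinfty_ge.
    have /andP[w1t0 w1t] := le1 t t0.
    apply: (@le_trans _ _ (e * `|w1 t|)); first by near: t; exact: ln1.
    by rewrite ler_pM2l// !ger0_norm// (le_trans w1t0).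
  + move=> w3 ww3 w123; exists w3; split => //.
    * exact: le_ll le1 w123.
    * exact: le_ll le2 w123.
Unshelve. all: by end_near. Qed.
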